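(* Let $\Omega\subseteq \mathbb{R}\times\mathbb{R}_+$ be a (Lebesgue measurable) set with positive measure and let $\phi\in L^2(\mathbb{R},\mathbb{R})$, $\phi\neq 0$, be an analyzing wavelet such that $\operatorname{Ran}\mathcal{W}_{\phi}\subseteq\mathscr{A}(\mathbb{C}^+)$. Then the following are equivalent for $f,g\in L^2(\mathbb{R},\mathbb{R})$: (i) $f=g$ or $f=-g$; (ii) $|\mathcal{W}_{\phi}f(b,a)|=|\mathcal{W}_{\phi}g(b,a)|$ for all $(b,a)\in\Omega$.
   Context: $\mathbb{R}_+=(0,+\infty)$, $L^2(\mathbb{R})$ is the space of complex-valued square-integrable functions on $\mathbb{R}$, and $L^2(\mathbb{R},\mathbb{R})$ is its subset of real-valued functions. For $\phi,f\in L^2(\mathbb{R})$ the wavelet transform of $f$ with respect to the analyzing wavelet $\phi$ is the function on $\mathbb{R}\times\mathbb{R}_+$ given by \[ \mathcal{W}_{\phi}f(b,a)=a^{-1/2}\int_{\mathbb{R}} f(x)\,\overline{\phi\left(\frac{x-b}{a}\right)}\,dx,\qquad b\in\mathbb{R},\ a\in\mathbb{R}_+. \] $\operatorname{Ran}\mathcal{W}_\phi=\{\mathcal{W}_\phi f: f\in L^2(\mathbb{R})\}$. $\mathscr{A}(\mathbb{C}^+)$ denotes the space of (complex-valued) real-analytic functions on the upper half-plane $\mathbb{C}^+=\{z\in\mathbb{C}:\operatorname{Im}z>0\}$, identified with $\mathbb{R}\times\mathbb{R}_+$ via $(b,a)\mapsto b+ia$; i.e. functions of the two real variables $(b,a)$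 that are locally given by convergent power series. *)

(* Defs.v *)
From mathcomp Require Import all_boot all_order all_algebra.
From mathcomp Require Import all_classical all_reals all_analysis.
From mathcomp Require Import complex.

Set Implicit Arguments.
Unset Strict Implicit.
Unset Printing Implicit Defensive.
Import Order.TTheory GRing.Theory Num.Theory.
Import numFieldNormedType.Exports.
Import ComplexField.Normc.
Local Open Scope classical_set_scope.
Local Open Scope ring_scope.
Local Open Scope complex_scope.

Section wavelet.
Context {R : realType}.
Local Notation mu := (@lebesgue_measure R).

(* Elements of L^2(R) are represented by Borel measurable functions (every
   square-integrable class contains one); equality in L^2(R) is equality almost
   everywhere. *)
Definition L2C : set (R -> R[i]) := [set f : R -> R[i] |
  [/\ measurable_fun setT (fun x : R => complex.Re (f x)),
      measurable_fun setT (fun x : R => complex.Im (f x)) &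
      finite_norm mu 2%:E (fun x => normc (f x))]].

Definition integralC (f : R -> R[i]) : R[i] :=
  (\int[mu]_x complex.Re (f x)) +i* (\int[mu]_x complex.Im (f x)).

(* Defined on all of R * R, but only the points (b, a) with 0 < a are meant. *)
Definition wavelet_transform (phi f : R -> R[i]) (ba : R * R) : R[i] :=
  (ba.2 `^ (- 2^-1))%:C *
  integralC (fun x => f x * conjc (phi ((x - ba.1) / ba.2))).

Definition Ran_wavelet (phi : R -> R[i]) : set (R * R -> R[i]) :=
  wavelet_transform phi @` L2C.

(* The double power series is required to converge absolutely, so that its sum
   does not depend on the order of summation; the sum is then computed along
   increasing total degree. *)
Definition real_analytic_at (F : R * R -> R[i]) (p : R * R) : Prop :=
  exists c : nat -> nat -> R[i], \forall q \near p,
    let term i j := c i j * ((q.1 - p.1) ^+ i * (q.2 - p.2) ^+ j)%:C in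
    summable [set: nat * nat] (fun ij => (normc (term ij.1 ij.2))%:E) /\
    [series \sum_(i < n.+1) term i (n - i)%N]_n @ \oo --> (F q : R[i]^o).

Definition analytic_upper_half_plane : set (R * R -> R[i]) :=
  [set F | forall p, 0 < p.2 -> real_analytic_at F p].

(* The product measure of the library lives on the Borel sets of the plane;
   Lebesgue measurability is Caratheodory measurability for the outer measure
   it induces. *)
Definition lebesgue_measurable2 : set (set (R * R)) :=
  ((mu \x mu)%E^*)%mu.-cara.-measurable.

Definition lebesgue_measure2 : set (R * R) -> \bar R :=
  @completed_measure_extension _ _ _ (mu \x mu)%E.

(* The real-valued elements of L2C are those of the library's real L^2 space. *)
Lemma L2C_real (f : R -> R) :
  L2C (fun x => (f x)%:C) <-> f \in Lfun mu 2%:E.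
Proof.
have fin : finite_norm mu 2%:E (fun x => normc (f x)%:C) = finite_norm mu 2%:E f.
  rewrite /finite_norm unlock /Lnorm; congr (_ `^ _ < _)%E.
  apply: eq_integral => x _ /=.
  by rewrite expr0n /= addr0 sqrtr_sqr normr_id.
rewrite /L2C /= fin; split=> [[mf _ ff]|].
  by apply/andP; split; rewrite inE.
by case/andP=> /[!inE] mf ff; split=> //; exact: measurable_cst.
Qed.

End wavelet.

(* Main.v *)
Require Import Defs.
From mathcomp Require Import all_boot all_order all_algebra.
From mathcomp Require Import all_classical all_reals all_analysis.
From mathcomp Require Import measurable_realfun complex.
From mathcomp Require Import ring lra.

Set Implicit Arguments.
Unset Strict Implicit.
Unset Printing Implicit Defensive.
Import Order.TTheory GRing.Theory Num.Theory.
Import numFieldNormedType.Exports.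
Local Open Scope classical_set_scope.
Local Open Scope ring_scope.

(** As f, g and phi are real, equality of the moduli on Omega says that the
    product of the real functions W(f - g) and W(f + g) vanishes on Omega, so
    that the zero set of one of them has positive measure.  The theorem then
    follows from two facts.

    Unique continuation (half_plane_eq0).  A real-analytic function on the upper
    half-plane whose zero set has positive measure is zero.  By Fubini, for a set
    B of abscissae b of positive measure the vertical slice through b vanishes on
    a set of positive measure, hence everywhere by the identity theorem in one
    variable (analytic_eq0); every horizontal slice then vanishes on B, hence
    everywhere.

    Injectivity of the wavelet transform (wavelet_injective).  If W h = 0 and
    phi is nonzero then h = 0.  This is where it matters that phi is real: for
    complex wavelets it fails on Hardy spaces.  The usual argument goes through
    the Fourier transform; the one given here is a version of Schur's lemma for
    the affine group acting on the real space L2.  Let N be the space of all h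
    orthogonal to every x |-> phi ((x - b) / a), and let q be the square of the
    distance to N.  Then q is a quadratic form, and q (A h) = a * q h when A
    substitutes (x - b) / a for x, since N is invariant under A.  So with
    c = q(1_]0,1]) one has q(1_]s,t]) = c (t - s), that is, the quadratic form
    E = q - c |.|^2 vanishes on the indicators of intervals.  Put
    e_t = 1_]0,t] for 0 <= t and e_t = - 1_]t,0] otherwise: all the differences
    e_s - e_t are, up to sign, such indicators, so the polar form of E vanishes
    on all pairs (e_s, e_t), and, by density of the step functions in L2
    (L2_induction), E = 0.  Hence q = c |.|^2.  But q phi = |phi|^2, because phi is
    orthogonal to N, so c = 1; and |h|^2 = q h = 0 for every h in N. *)

(** * Quadratic forms on a real vector space *)

Section quadratic_forms.
Context {R : realType} {V : lmodType R}.
Implicit Types (E n : V -> R) (x y z : V).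

(** The parallelogram law and homogeneity.  No bilinear form is given in
    advance: the squared distance to a subspace is first seen to be quadratic
    in this sense, and its polar form is recovered from it. *)
Definition quadratic E :=
  (forall x y, E (x + y) + E (x - y) = 2 * E x + 2 * E y) /\
  (forall r x, E (r *: x) = r ^+ 2 * E x).

(** Four times the symmetric bilinear form attached to E. *)
Definition polar E x y := E (x + y) - E (x - y).

Lemma quadraticB E1 E2 c : quadratic E1 -> quadratic E2 ->
  quadratic (fun x => E1 x - c * E2 x).
Proof.
move=> [p1 h1] [p2 h2]; split=> [x y|r x]; last by rewrite h1 h2; ring.
by have := p1 x y; have := congr1 ( *%R c) (p2 x y); rewrite !mulrDr; lra.
Qed.

Section polarisation.
Variables (E : V -> R).
Hypothesis qE : quadratic E.

Let par x y : E (x + y) + E (x - y) = 2 * E x + 2 * E y.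
Proof. exact: qE.1. Qed.

Let homog r x : E (r *: x) = r ^+ 2 * E x.
Proof. exact: qE.2. Qed.

Lemma quadratic0 : E 0 = 0.
Proof. by rewrite -(scale0r 0) homog expr0n mul0r. Qed.

Lemma quadraticN x : E (- x) = E x.
Proof. by rewrite -scaleN1r homog sqrrN expr1n mul1r. Qed.

Lemma polarC x y : polar E x y = polar E y x.
Proof. by rewrite /polar (addrC x) -(quadraticN (x - y)) opprB. Qed.

Lemma polarxx x : polar E x x = 4 * E x.
Proof.
rewrite /polar subrr quadratic0 subr0.
have -> : x + x = 2 *: x by rewrite scaler_nat mulr2n.
by rewrite homog; congr (_ * _); ring.
Qed.

Lemma polarE x y : polar E x y = 2 * (E x + E y - E (x - y)).
Proof. have h := par x y; rewrite /polar; lra. Qed.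

(** The argument of Jordan and von Neumann: subtracting the parallelogram laws
    for (x + y, x + z) and (x - y, x - z) gives a doubled form of additivity,
    from which the doubling is then removed by taking one vector to be 0. *)
Lemma polarDr x y z : polar E x (y + z) = polar E x y + polar E x z.
Proof.
have E0 := quadratic0.
have dbl a b c : polar E (2 *: a) (b + c) = 2 * polar E a b + 2 * polar E a c.
  rewrite /polar.
  have h1 := par (a + b) (a + c); have h2 := par (a - b) (a - c).
  have e1 : a + b + (a + c) = 2 *: a + (b + c).
    by rewrite addrACA scaler_nat mulr2n.
  have e2 : a - b + (a - c) = 2 *: a - (b + c).
    by rewrite addrACA scaler_nat mulr2n opprD.
  have e3 : a + b - (a + c) = b - c by rewrite opprD addrACA subrr add0r.
  have e4 : a - b - (a - c) = - (b - c).
    by rewrite [- (a - c)]opprB addrC addrA subrK opprB.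
  rewrite e1 e3 in h1; rewrite e2 e4 quadraticN in h2; lra.
have h0 : polar E (2 *: x) (y + z) = 2 * polar E x (y + z).
  have p0 : polar E x 0 = 0 by rewrite /polar subr0 addr0 subrr.
  by rewrite -{1}[y + z]addr0 dbl p0 mulr0 addr0.
by have := dbl x y z; rewrite h0 => ?; lra.
Qed.

Section bounded.
Variable n : V -> R.
Hypothesis (qn : quadratic n) (En : forall x, `|E x| <= n x).

Lemma polar_bound x y : `|polar E x y| <= 2 * (n x + n y).
Proof.
have /= h := qn.1 x y; rewrite /polar.
have := En (x + y); have := En (x - y); rewrite !ler_norml.
by move=> /andP[a1 a2] /andP[a3 a4]; apply/andP; split; lra.
Qed.

(** The defect M of homogeneity is additive and vanishes on the integers, so it
    is determined by its values on [0, 1], where the bound on E controls it; an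
    additive function that is bounded is zero. *)
Lemma polarZr r x y : polar E x (r *: y) = r * polar E x y.
Proof.
pose M t := polar E x (t *: y) - t * polar E x y.
have MD s t : M (s + t) = M s + M t by rewrite /M scalerDl polarDr; ring.
have M1 : M 1 = 0 by rewrite /M scale1r mul1r subrr.
have M0 : M 0 = 0.
  by have := MD 0 0; rewrite addr0 => /esym/eqP; rewrite -subr_eq0 addrK => /eqP.
have Mnat t k : M (t *+ k) = M t *+ k.
  by elim: k => [|k IH]; rewrite ?mulr0n// !mulrS MD IH.
have MN t : M (- t) = - M t.
  by apply/eqP; rewrite -addr_eq0 -MD addNr M0.
have Mint (k : int) : M k%:~R = 0.
  case: k => k.
    by rewrite -pmulrn Mnat M1 mul0rn.
  by rewrite NegzE mulrNz MN -pmulrn Mnat M1 mul0rn oppr0.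
pose C := 2 * (n x + n y) + `|polar E x y|.
have n0 z : 0 <= n z by exact: le_trans (normr_ge0 _) (En z).
have Mbnd t : `|M t| <= C.
  have -> : M t = M (t - (Num.floor t)%:~R).
    by rewrite MD MN Mint oppr0 addr0.
  have := floor_le_tmp t; have := floorD1_gt t.
  set s := t - _; rewrite intrD1 => h1 h2.
  have s0 : 0 <= s by rewrite /s; lra.
  have s1 : s <= 1 by rewrite /s; lra.
  have := polar_bound x (s *: y); rewrite qn.2 => h3.
  have h4 : s ^+ 2 * n y <= n y.
    by rewrite ler_piMl// expr_le1.
  apply: le_trans (ler_normB _ _) _; rewrite normrM ger0_norm// /C.
  apply: lerD; first lra.
  by rewrite ler_piMl.
suff: M r = 0 by rewrite /M => /eqP; rewrite subr_eq0 => /eqP.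
apply/eqP; rewrite -normr_le0 leNgt; apply/negP => Mr0.
have [k kC] : exists k : nat, C < `|M r| * k%:R.
  exists (Num.truncn (C / `|M r|)).+1.
  by rewrite -ltr_pdivrMl// mulrC truncnS_gt.
have := Mbnd (r *+ k); rewrite Mnat normrMn -mulr_natr leNgt => /negP; exact.
Qed.

(** Continuity of the polar form in its second argument.  The bound
    n x + n (y - z) is not small by itself; replacing y - z by a large multiple
    t (y - z) and dividing by t makes it so. *)
Lemma polar_approx x y :
  (forall e, 0 < e -> exists z, n (y - z) <= e /\ polar E x z = 0) ->
  polar E x y = 0.
Proof.
move=> H; have n0 z : 0 <= n z by exact: le_trans (normr_ge0 _) (En z).
apply/eqP; rewrite -normr_le0; apply/ler_addgt0Pr => e e0; rewrite add0r.
(* With this t, both 2 n x / t and 2 t n (y - z) are at most e / 2. *)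
pose t := 4 * (n x + 1) / e.
have t0 : 0 < t by rewrite divr_gt0// mulr_gt0// ltr_wpDl.
have [z [zy z0]] := H (e / (4 * t)) (divr_gt0 e0 (mulr_gt0 (ltr0n _ 4) t0)).
have -> : polar E x y = t^-1 * polar E x (t *: (y - z)).
  rewrite polarZr mulKf ?gt_eqF// -scaleN1r polarDr polarZr z0; ring.
rewrite normrM gtr0_norm ?invr_gt0// mulrC ler_pdivrMr//.
apply: le_trans (polar_bound _ _) _; rewrite qn.2.
have h1 : e * t = 4 * (n x + 1) by rewrite /t mulrC divfK// gt_eqF.
have h2 : t ^+ 2 * n (y - z) <= t ^+ 2 * (e / (4 * t)).
  by rewrite ler_wpM2l// sqr_ge0.
have h3 : t ^+ 2 * (e / (4 * t)) = e * t / 4 by field; rewrite gt_eqF.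
by have := n0 x; lra.
Qed.

End bounded.
End polarisation.

Section distance.
Variables (n : V -> R) (N : set V).
Hypotheses (qn : quadratic n) (n_ge0 : forall x, 0 <= n x).
Hypotheses (N0 : N 0) (ND : forall x y, N x -> N y -> N (x + y))
  (NZ : forall r x, N x -> N (r *: x)).

Definition sqdist x := inf [set n (x - k) | k in N].

Lemma sqdist_le x k : N k -> sqdist x <= n (x - k).
Proof. by move=> Nk; apply: ge_inf; [exists 0 => _ [z _ <-] | exists k]. Qed.

Lemma le_sqdist x r : (forall k, N k -> r <= n (x - k)) -> r <= sqdist x.
Proof.
move=> H; apply: lb_le_inf; first by exists (n (x - 0)); exists 0.
by move=> _ [k Nk <-]; exact: H.
Qed.

Lemma sqdist_ge0 x : 0 <= sqdist x.
Proof. exact: le_sqdist. Qed.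

Lemma sqdist_bound x : sqdist x <= n x.
Proof. by rewrite -{2}[x]subr0; exact: sqdist_le. Qed.

Lemma sqdist_mem x : N x -> sqdist x = 0.
Proof.
move=> Nx; apply/eqP; rewrite eq_le sqdist_ge0 andbT.
by rewrite (le_trans (sqdist_le x Nx))// subrr (quadratic0 qn).
Qed.

Lemma sqdist_adherent x e : 0 < e -> exists2 k, N k & n (x - k) < sqdist x + e.
Proof.
move=> e0; have [|_ [k Nk <-] ?] := @inf_adherent _ [set n (x - k) | k in N] e e0.
  by split; [exists (n (x - 0)); exists 0 | exists 0 => _ [z _ <-]].
by exists k.
Qed.

Lemma sqdistZ r x : sqdist (r *: x) = r ^+ 2 * sqdist x.
Proof.
have le a y : sqdist (a *: y) <= a ^+ 2 * sqdist y.
  apply/ler_addgt0Pr => e e0.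
  have a1 : 0 < a ^+ 2 + 1 by rewrite ltr_wpDl// sqr_ge0.
  have [k Nk kx] := sqdist_adherent y (divr_gt0 e0 a1).
  apply: le_trans (sqdist_le _ (NZ a Nk)) _; rewrite -scalerBr qn.2.
  apply: le_trans (ler_wpM2l (sqr_ge0 _) (ltW kx)) _.
  rewrite mulrDr lerD2l mulrCA ler_piMr ?(ltW e0)// ler_pdivrMr//; lra.
apply/eqP; rewrite eq_le le /=; have [->|r0] := eqVneq r 0.
  by rewrite expr0n mul0r sqdist_ge0.
have := le r^-1 (r *: x); rewrite scalerK// => /(ler_wpM2l (sqr_ge0 r)).
by rewrite mulrA -exprMn mulfV// expr1n mul1r.
Qed.

(** Adding near-minimisers h of n (x - h) and k of n (y - k) gives one
    inequality of the parallelogram law; applied to x + y and x - y, with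
    homogeneity, the same inequality is the converse one. *)
Lemma sqdist_quadratic : quadratic sqdist.
Proof.
split; last exact: sqdistZ.
have le x y : sqdist (x + y) + sqdist (x - y) <= 2 * sqdist x + 2 * sqdist y.
  apply/ler_addgt0Pr => e e0.
  have e4 : 0 < e / 4 by rewrite divr_gt0.
  have [h Nh hx] := sqdist_adherent x e4.
  have [k Nk ky] := sqdist_adherent y e4.
  have := qn.1 (x - h) (y - k).
  have -> : x - h + (y - k) = x + y - (h + k) by rewrite addrACA opprD.
  have -> : x - h - (y - k) = x - y - (h - k).
    by rewrite [- (y - k)]opprD [- (h - k)]opprD addrACA.
  have Nhk : N (h - k) by rewrite -scaleN1r; apply: ND => //; exact: NZ.
  have := sqdist_le (x + y) (ND Nh Nk).
  by have := sqdist_le (x - y) Nhk; lra.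
move=> x y; apply/eqP; rewrite eq_le le /=.
have := le (x + y) (x - y).
have -> : x + y + (x - y) = 2 *: x by rewrite addrACA subrr addr0 scaler_nat mulr2n.
have -> : x + y - (x - y) = 2 *: y.
  by rewrite opprB addrCA [x + _]addrC addrK scaler_nat mulr2n.
by rewrite !sqdistZ; lra.
Qed.

End distance.
End quadratic_forms.

(** * Affine substitutions and the scalar product of L2 *)

Section affine_change_of_variable.
Context {R : realType}.
Local Notation mu := (@lebesgue_measure R).

Lemma measurable_affine (a b : R) :
  measurable_fun setT (fun x : R => (x - b) / a).
Proof. by apply: measurable_funM => //; exact: measurable_funB. Qed.

(** The image of Lebesgue measure under x |-> (x - b) / a, divided by a, gives
    each interval its length, so it is Lebesgue measure. *)
Lemma ge0_integral_affine (f : R -> \bar R) (a b : R) : 0 < a ->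
  measurable_fun setT f -> (forall x, (0 <= f x)%E) ->
  (\int[mu]_x f ((x - b) / a)%R = a%:E * \int[mu]_x f x)%E.
Proof.
move=> a0 mf f0.
have ia0 : 0 <= a^-1 by rewrite invr_ge0 ltW.
pose A (x : measurableTypeR R) : measurableTypeR R := (x - b) / a.
have mA : measurable_fun setT A by exact: measurable_affine.
pose m' : {measure set (measurableTypeR R) -> \bar R} :=
  mscale (NngNum ia0) (pushforward mu A).
pose m := m' mA.
have mE X : measurable X -> mu X = m X.
  apply: lebesgue_measure_unique => _ [[c d] _ <-] /=.
  rewrite /m /m' /mscale /= /pushforward.
  have -> : A @^-1` `]c, d] = `]c * a + b, d * a + b]%classic.
    by apply/seteqP; split=> x /=;
      rewrite !in_itv/= ltr_pdivlMr// ler_pdivrMr// ltrBrDr lerBlDr.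
  rewrite !lebesgue_measure_itv /= !lte_fin ltrD2r ltr_pM2r//.
  case: ifPn => _; last by rewrite mule0.
  by rewrite -!EFinB -EFinM; congr (_%:E); field; rewrite gt_eqF.
rewrite [in RHS](eq_measure_integral m); last by move=> X mX _; exact: mE.
rewrite ge0_integral_mscale//= ge0_integral_pushforward//.
by rewrite preimage_setT muleA -EFinM divff ?gt_eqF// mul1e.
Qed.

Lemma integrable_affine (f : R -> R) (a b : R) : 0 < a ->
  mu.-integrable setT (EFin \o f) ->
  mu.-integrable setT (EFin \o (fun x => f ((x - b) / a))).
Proof.
move=> a0 /integrableP[mf fi]; apply/integrableP; split.
  exact: (measurableT_comp mf (measurable_affine a b)).
rewrite (ge0_integral_affine (f := fun x => `|(f x)%:E|%E))//.
  by rewrite lte_mul_pinfty// lee_fin ltW.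
exact: (measurableT_comp _ mf).
Qed.

Lemma Rintegral_affine (f : R -> R) (a b : R) : 0 < a ->
  mu.-integrable setT (EFin \o f) ->
  \int[mu]_x f ((x - b) / a) = a * \int[mu]_x f x.
Proof.
move=> a0 fi; have mf : measurable_fun setT (EFin \o f) by case/integrableP : fi.
rewrite /Rintegral integralE [in RHS]integralE.
have e1 := ge0_integral_affine b a0 (measurable_funepos mf)
  (fun x => funepos_ge0 _ x).
have e2 := ge0_integral_affine b a0 (measurable_funeneg mf)
  (fun x => funeneg_ge0 _ x).
transitivity (fine (a%:E * \int[mu]_x (EFin \o f)^\+ x
                    - a%:E * \int[mu]_x (EFin \o f)^\- x)%E).
  rewrite -e1 -e2; congr (fine (_ - _)%E);
    by apply: eq_integral => x _; rewrite !unlock.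
have f1 := integral_fune_fin_num measurableT (integrable_funepos measurableT fi).
have f2 := integral_fune_fin_num measurableT (integrable_funeneg measurableT fi).
by rewrite -(fineK f1) -(fineK f2) -!EFinM -!EFinB /= mulrBr.
Qed.

Lemma Lfun2P (f : R -> R) : f \in Lfun mu 2%:E <->
  measurable_fun setT f /\ mu.-integrable setT (EFin \o (fun x => f x ^+ 2)).
Proof.
split=> [f2|[mf fi]].
  split; last exact: Lfun2_integrable_sqr.
  by case/andP : f2 => /[!inE].
apply/andP; split; rewrite inE//= /finite_norm unlock /Lnorm poweR_lty//.
under eq_integral => x _ do rewrite /= powR_mulrn// -normrX.
by case/integrableP : fi.
Qed.

Lemma Lfun2_affine (f : R -> R) (a b : R) : 0 < a -> f \in Lfun mu 2%:E ->
  (fun x => f ((x - b) / a)) \in Lfun mu 2%:E.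
Proof.
move=> a0 /Lfun2P[mf fi]; apply/Lfun2P; split.
  exact: (measurableT_comp mf (measurable_affine a b)).
exact: (integrable_affine b a0 fi).
Qed.
End affine_change_of_variable.

Section square_norm.
Context {R : realType}.
Local Notation mu := (@lebesgue_measure R).
Local Notation L2 := (LfunType mu (lee1n 2)).
Implicit Types f g h : L2.

Lemma integrable_mul f g : mu.-integrable setT (EFin \o (fun x => f x * g x)).
Proof. by apply/Lfun1_integrable/Lfun2_mul_Lfun1; exact: LfunP. Qed.

Definition dotp f g : R := \int[mu]_x (f x * g x).
Definition sqnorm f : R := dotp f f.

Lemma L2DE f g x : (f + g) x = f x + g x. Proof. by []. Qed.
Lemma L2ZE r f x : (r *: f) x = r * f x. Proof. by []. Qed.
Lemma L2NE f x : (- f) x = - f x. Proof. by []. Qed.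

Lemma dotpC f g : dotp f g = dotp g f.
Proof. by apply: eq_Rintegral => x _; rewrite mulrC. Qed.

Lemma dotpDl f g h : dotp (f + g) h = dotp f h + dotp g h.
Proof.
rewrite /dotp -RintegralD//; try exact: integrable_mul.
by apply: eq_Rintegral => x _; rewrite L2DE mulrDl.
Qed.

Lemma dotpZl r f g : dotp (r *: f) g = r * dotp f g.
Proof.
rewrite /dotp -RintegralZl//; try exact: integrable_mul.
by apply: eq_Rintegral => x _; rewrite L2ZE mulrA.
Qed.

Lemma dotpDr f g h : dotp f (g + h) = dotp f g + dotp f h.
Proof. by rewrite dotpC dotpDl !(dotpC f). Qed.

Lemma dotpZr r f g : dotp f (r *: g) = r * dotp f g.
Proof. by rewrite dotpC dotpZl dotpC. Qed.

Lemma sqnormD f g : sqnorm (f + g) = sqnorm f + 2 * dotp f g + sqnorm g.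
Proof. by rewrite /sqnorm dotpDl !dotpDr (dotpC g f); ring. Qed.

Lemma sqnormB f g : sqnorm (f - g) = sqnorm f - 2 * dotp f g + sqnorm g.
Proof.
rewrite /sqnorm -scaleN1r dotpDl !dotpDr !dotpZl !dotpZr (dotpC g f); ring.
Qed.

Lemma sqnorm_ge0 f : 0 <= sqnorm f.
Proof. by apply: Rintegral_ge0 => x _; rewrite -expr2 sqr_ge0. Qed.

Lemma sqnorm_eq0 f : sqnorm f = 0 -> f = cst 0 %[ae mu].
Proof.
rewrite /sqnorm /dotp /Rintegral => f0.
have fi := integrable_mul f f.
have mf : measurable_fun setT (EFin \o (fun x => f x * f x)).
  by case/integrableP : fi.
have : (\int[mu]_x `|(f x * f x)%:E| = 0)%E.
  transitivity (\int[mu]_x (f x * f x)%:E)%E.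
    by apply: eq_integral => x _; rewrite gee0_abs// lee_fin -expr2 sqr_ge0.
  by rewrite -(fineK (integral_fune_fin_num measurableT fi)) f0.
move=> /(ae_eq_integral_abs mu measurableT mf); apply: filterS => x /(_ I) /= [].
by move=> /eqP; rewrite mulf_eq0 orbb => /eqP.
Qed.

Definition L2_affine (a b : R) (a0 : 0 < a) f : L2 :=
  Lfun_Sub (lee1n 2) (Lfun2_affine b a0 (LfunP f)).

Lemma sqnorm_affine a b (a0 : 0 < a) f :
  sqnorm (L2_affine b a0 f) = a * sqnorm f.
Proof. exact: (Rintegral_affine b a0 (integrable_mul f f)). Qed.

Lemma L2_affineB a b (a0 : 0 < a) f g :
  L2_affine b a0 (f - g) = L2_affine b a0 f - L2_affine b a0 g.
Proof. by apply/LfuneqP. Qed.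
End square_norm.

(** * Density of the step functions in L2 *)

Section density.
Import HBNNSimple.
Context {R : realType}.
Local Notation mu := (@lebesgue_measure R).
Local Notation L2 := (LfunType mu (lee1n 2)).

Lemma Lfun2_bounded (f h : R -> R) : measurable_fun setT f ->
  h \in Lfun mu 2%:E -> (forall x, `|f x| <= h x) -> f \in Lfun mu 2%:E.
Proof.
move=> mf /Lfun2P[mh hi] fh; apply/Lfun2P; split => //.
apply: (le_integrable measurableT _ _ hi).
  by apply/measurable_EFinP; exact: measurable_funX.
move=> x _ /=; rewrite lee_fin !normrX ler_pXn2r ?nnegrE//.
exact: le_trans (fh x) (ler_norm _).
Qed.

Lemma cvg_norm_le (u : nat -> R) (l r : R) :
  u @ \oo --> l -> (forall n, `|u n| <= r) -> `|l| <= r.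
Proof.
move=> ul ur; have ncv : (fun n => `|u n|) @ \oo --> `|l| by exact: cvg_norm.
rewrite -(cvg_lim _ ncv)//; apply: limr_le; first exact: cvgP ncv.
exact: nearW.
Qed.

(** Dominated convergence for the squares, with dominating function 4 h^2. *)
Lemma sqnorm_dominated_cvg (g : nat -> L2) (f : L2) (h : R -> R) :
  h \in Lfun mu 2%:E -> (forall m x, `|g m x| <= h x) ->
  (forall x, g ^~ x @ \oo --> f x) ->
  forall e, 0 < e -> exists m, sqnorm (f - g m) <= e.
Proof.
move=> h2 gh gf e e0.
have [mh hi] := (Lfun2P h).1 h2.
have fh x : `|f x| <= h x by exact: cvg_norm_le (gf x) (gh ^~ x).
have sqE m : (sqnorm (f - g m))%:E = (\int[mu]_x (((f - g m) x) ^+ 2)%:E)%E.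
  rewrite /sqnorm /dotp /Rintegral fineK//.
  exact: integral_fune_fin_num (integrable_mul _ _).
have [|||||_ _] := @dominated_convergence _ _ _ mu setT measurableT
  (fun m x => (((f - g m) x) ^+ 2)%:E) (cst 0%E) (fun x => (4 * h x ^+ 2)%:E).
- move=> m; apply/measurable_EFinP; apply: measurable_funX.
  by case/andP : (LfunP (f - g m)) => /[!inE].
- exact: measurable_cst.
- apply: nearW => x _ /=.
  apply: cvg_EFin; first exact: nearW.
  rewrite -[X in _ --> X](expr0n R 2).
  apply: (@cvg_comp _ _ _ (fun m => (f - g m) x) (fun y : R => y ^+ 2) _
    (nbhs (0 : R))); last exact: exprn_continuous.
  rewrite -(subrr (f x)); apply: (cvgB (f := fun=> f x) (g := g ^~ x)).
    exact: cvg_cst.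
  exact: gf.
- exact: (integrableZl measurableT 4 hi).
- apply: nearW => x m _ /=.
  rewrite lee_fin ger0_norm ?sqr_ge0// -real_normK ?num_real//.
  have : `|(f - g m) x| <= 2 * h x.
    by rewrite (le_trans (ler_normB _ _))//; have := fh x; have := gh m x; lra.
  have h0 : 0 <= h x by exact: le_trans (normr_ge0 _) (fh x).
  move=> /(lerXn2r 2); rewrite !nnegrE exprMn -natrX => -> //.
  exact: mulr_ge0.
rewrite integral0 => /fine_cvgP[_ /cvgrPdist_le /(_ e e0)].
move=> [m _ /(_ m (leqnn m))] /=; rewrite sub0r normrN => me; exists m.
by move: me; rewrite -sqE /= ger0_norm ?sqnorm_ge0.
Qed.

(** The density of the step functions as an induction principle: a closed linear
    condition S on L2 need only be checked on the indicators of intervals. *)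
Section induction.
Variable S : set L2.
Hypothesis SD : forall f g, S f -> S g -> S (f + g).
Hypothesis SZ : forall r f, S f -> S (r *: f).
Hypothesis Scl : forall f,
  (forall e, 0 < e -> exists g, S g /\ sqnorm (f - g) <= e) -> S f.
Hypothesis Sitv : forall (f : L2) a b,
  (f : R -> R) = \1_(`]a, b]%classic : set R) -> S f.

(* S is moved to functions, so that pointwise limits can be taken before the
   limit is known to be square-integrable. *)
Let T (f : R -> R) := exists2 F : L2, (F : R -> R) = f & S F.

Let TD f g : T f -> T g -> T (fun x => f x + g x).
Proof. by move=> [F <- SF] [G <- SG]; exists (F + G) => //; exact: SD. Qed.

Let TZ r f : T f -> T (fun x => r * f x).
Proof. by move=> [F <- SF]; exists (r *: F) => //; exact: SZ. Qed.

Let Tlim (g : nat -> R -> R) (f h : R -> R) : h \in Lfun mu 2%:E ->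
  (forall m, T (g m)) -> (forall m x, `|g m x| <= h x) ->
  (forall x, g ^~ x @ \oo --> f x) -> T f.
Proof.
move=> h2 Tg gh gf.
have mg m : measurable_fun setT (g m).
  have [G <- _] := Tg m.
  by case/andP : (LfunP G) => /[!inE].
have f2 : f \in Lfun mu 2%:E.
  apply: (Lfun2_bounded _ h2) => [|x]; last exact: cvg_norm_le (gf x) (gh ^~ x).
  by apply: (measurable_fun_cvg mg) => x _; exact: gf.
pose F := Lfun_Sub (lee1n 2) f2.
have /(_ _)/cid2-/all_sig2[G GE SG] : forall m, T (g m) := Tg.
exists F => //; apply: Scl => e e0.
have [|x|m me] := @sqnorm_dominated_cvg G F h h2 _ _ e e0.
- by move=> m x; rewrite GE.
- by under eq_fun do rewrite GE; exact: gf.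
by exists (G m).
Qed.

(* All sets are cut down to the bounded intervals J n to keep their
   measures finite. *)
Let J (n : nat) : set R := `]- n%:R, n%:R]%classic.

Lemma indic_itv_Lfun2 (a b : R) : \1_(`]a, b]%classic : set R) \in Lfun mu 2%:E.
Proof.
apply/Lfun2P; split; first exact: measurable_indic.
apply/integrableP; split.
  by apply/measurable_EFinP; apply: measurable_funX; exact: measurable_indic.
rewrite [ltLHS](_ : _ = mu `]a, b]%classic).
  by rewrite lebesgue_measure_itv/=; case: ifP => //; rewrite -EFinB ltry.
rewrite -[X in mu X]setIT -integral_indic//; apply: eq_integral => x _ /=.
by rewrite indicE; case: (_ \in _); rewrite ?expr1n ?expr0n/= ?normr1 ?normr0.
Qed.

(* Intervals form a pi-system, and the sets whose trace on J n has its
   indicator in S form a Dynkin system. *)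
Let T_indic (n : nat) (A : set R) : measurable A -> T (\1_(A `&` J n)).
Proof.
have Titv a b : T (\1_(`]a, b]%classic : set R)).
  by exists (Lfun_Sub (lee1n 2) (indic_itv_Lfun2 a b)) => //; exact: Sitv.
have TocI X : ocitv X -> T (\1_(X `&` J n)).
  move=> oX; have [[a b] _ <-] := ocitvI oX (is_ocitv (- n%:R) n%:R).
  exact: Titv.
move=> mA; apply: (@dynkin_induction _ (measurableTypeR R) (@ocitv R)
  (fun A => T (\1_(A `&` J n)))) => //.
- exact: ocitvI.
- by rewrite setTI; exact: Titv.
- move=> X _ TX.
  have -> : \1_(~` X `&` J n) =
      (fun x => \1_(J n) x + (-1) * \1_(X `&` J n) x) :> (R -> R).
    apply/funext => x; rewrite !indicE !in_setI in_setC.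
    by case: (x \in X); case: (x \in J n) => /=; ring.
  by apply: TD; [exact: Titv | exact: TZ].
- move=> F mF tF TF.
  have TU m : T (\1_((\big[setU/set0]_(k < m) F k) `&` J n)).
    elim: m => [|m IH].
      have -> : \1_((\big[setU/set0]_(k < 0) F k) `&` J n) =
          \1_(`]0, 0]%classic : set R) :> (R -> R).
        by rewrite big_ord0 set0I set_itvoc0.
      exact: Titv.
    have -> : \1_((\big[setU/set0]_(k < m.+1) F k) `&` J n) =
        (fun x => \1_((\big[setU/set0]_(k < m) F k) `&` J n) x +
          \1_(F m `&` J n) x) :> (R -> R).
      apply/funext => x; rewrite big_ord_recr/= !indicE !in_setI in_setU.
      have : ~~ ((x \in \big[setU/set0]_(k < m) F k) && (x \in F m)).
        apply/negP => /andP[/set_mem]; rewrite -bigcup_mkord.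
        move=> -[k /= km Fk] /set_mem Fm.
        have kE := tF k m I I (ex_intro _ x (conj Fk Fm)).
        by rewrite kE ltnn in km.
      by case: (x \in _); case: (x \in F m); case: (x \in J n) => //= _; ring.
    exact: TD.
  apply: (Tlim (indic_itv_Lfun2 (- n%:R) n%:R) TU) => [m x|x].
    rewrite !indicE in_setI; case: (x \in \big[_/_]_(_ < _) _) => /=.
      by rewrite ger0_norm.
    by rewrite normr0.
  apply: cvg_near_cst.
  have [[k _ Fk]|nF] := pselect ((\bigcup_k F k) x).
    exists k.+1 => // m /= km; rewrite !indicE !in_setI.
    rewrite (_ : x \in \big[_/_]_(_ < _) _ = true); last first.
      by apply/mem_set; rewrite -bigcup_mkord; exists k.
    by rewrite (_ : x \in \bigcup_k F k = true)//; apply/mem_set; exists k.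
  apply: nearW => m; rewrite !indicE !in_setI (memNset nF).
  by rewrite memNset// -bigcup_mkord => -[k _ Fk]; apply: nF; exists k.
Qed.

(** A nonnegative f in L2 is the dominated limit of its simple approximations
    cut off to J m, which are combinations of indicators; a general f is a
    difference of two nonnegative functions. *)
Lemma L2_induction f : S f.
Proof.
have Tnneg (h : R -> R) : h \in Lfun mu 2%:E -> (forall x, 0 <= h x) -> T h.
  move=> h2 h0; have [mh _] := (Lfun2P h).1 h2.
  have mEh : measurable_fun setT (EFin \o h) by exact/measurable_EFinP.
  pose s (m : nat) : {nnsfun R >-> R} := nnsfun_approx measurableT mEh m.
  have sh x : (fun m => (s m : R -> R) x) @ \oo --> h x.
    have c : (EFin \o (fun m => s m x)) @ \oo --> (EFin \o h) x.
      by apply: cvg_nnsfun_approx => // y _; rewrite lee_fin.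
    exact: (fine_cvg c).
  have sle m x : s m x <= h x.
    rewrite -(cvg_lim _ (sh x))//.
    apply: nondecreasing_cvgn_le; last exact: cvgP (sh x).
    by move=> a b ab; exact/lefP/nd_nnsfun_approx.
  apply: (@Tlim (fun m x => s m x * \1_(J m) x) h h h2).
  - move=> m.
    have mk y : measurable (s m @^-1` [set y] : set R) by exact: measurable_sfunP.
    suff TS (r : seq R) :
        T (fun x => \sum_(y <- r) y * \1_((s m @^-1` [set y]) `&` J m) x).
      rewrite (_ : (fun x => _) =
        (fun x => \sum_(y <- finmap.enum_fset (fset_set (range (s m))))
         y * \1_((s m @^-1` [set y]) `&` J m) x)); first exact: TS.
      apply/funext => x; rewrite fimfunE fsbig_finite//= big_distrl/=.
      by apply: eq_bigr => y _; rewrite indicI/= mulrA.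
    elim: r => [|y r IH].
      rewrite (_ : (fun x => _) = (fun x => 0 * \1_(setT `&` J m) x)).
        by apply: TZ; exact: T_indic.
      by apply/funext => x; rewrite big_nil mul0r.
    under eq_fun do rewrite big_cons.
    by apply: TD => //; apply: TZ; exact: T_indic.
  - move=> m x; rewrite normrM ger0_norm// indicE.
    by case: (_ \in _); rewrite ?normr1 ?mulr1 ?normr0 ?mulr0.
  - move=> x; rewrite -[h x]mulr1; apply: cvgM => //; apply: cvg_near_cst.
    exists (Num.truncn `|x|).+1 => // m /= xm.
    rewrite indicE mem_set// /J /= in_itv/=.
    have : `|x| < m%:R by rewrite (lt_le_trans (truncnS_gt _))// ler_nat.
    by rewrite ltr_norml => /andP[-> /ltW].
have [mf _] := (Lfun2P f).1 (LfunP f).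
have mnf : measurable_fun setT (fun x => `|f x|) by exact: measurableT_comp.
have nf2 : (fun x => `|f x|) \in Lfun mu 2%:E.
  apply/Lfun2P; split => //; have := ((Lfun2P f).1 (LfunP f)).2.
  by under eq_fun do rewrite -(real_normK (num_real _)).
pose p x := 2^-1 * (`|f x| + f x); pose q x := 2^-1 * (`|f x| - f x).
have pq0 x : 0 <= p x <= `|f x| /\ 0 <= q x <= `|f x|.
  have := ler_norm (f x); have := ler_norm (- f x); rewrite normrN /p /q.
  by move=> h1 h2; split; apply/andP; split; lra.
have Tp : T p.
  apply: Tnneg => [|x]; last by have [/andP[]] := pq0 x.
  apply: (Lfun2_bounded _ nf2) => [|x].
    by apply: measurable_funM => //; exact: measurable_funD.
  by have [/andP[p0 ?] _] := pq0 x; rewrite ger0_norm.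
have Tq : T q.
  apply: Tnneg => [|x]; last by have [_ /andP[]] := pq0 x.
  apply: (Lfun2_bounded _ nf2) => [|x].
    by apply: measurable_funM => //; exact: measurable_funB.
  by have [_ /andP[p0 ?]] := pq0 x; rewrite ger0_norm.
have [F Ff SF] := TD Tp (TZ (-1) Tq).
suff -> : f = F by [].
by apply/LfuneqP => x; rewrite Ff /p /q; field.
Qed.
End induction.
End density.

(** * Schur's lemma for the affine group *)

Section interval_indicators.
Context {R : realType}.
Local Notation mu := (@lebesgue_measure R).
Local Notation L2 := (LfunType mu (lee1n 2)).

Lemma sqnorm_quadratic : quadratic (@sqnorm R).
Proof.
split=> [f g|r f]; first by rewrite sqnormD sqnormB; ring.
by rewrite /sqnorm dotpZl dotpZr; ring.
Qed.

Definition indic_itv (a b : R) : L2 := Lfun_Sub (lee1n 2) (indic_itv_Lfun2 a b).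

Lemma indic_itvE (a b x : R) : indic_itv a b x = (a < x <= b)%R%:R.
Proof. by rewrite /= indicE mem_setE in_itv. Qed.

Lemma sqnorm_indic_itv a b : a <= b -> sqnorm (indic_itv a b) = b - a.
Proof.
move=> ab; rewrite /sqnorm /dotp.
transitivity (\int[mu]_x (\1_(`]a, b]%classic : set R) x : R)).
  apply: eq_Rintegral => x _ /=.
  by rewrite indicE; case: (_ \in _); rewrite ?mulr1 ?mulr0.
rewrite /Rintegral integral_indic//= setIT.
rewrite [X in fine X](_ : _ = mu `]a, b]%classic)// lebesgue_measure_itv/= lte_fin.
by case: ltP => //= ba; apply/esym/eqP; rewrite subr_eq0 eq_le ba ab.
Qed.

Lemma indic_itv_affine a b (ab : 0 < b - a) :
  indic_itv a b = L2_affine a ab (indic_itv 0 1).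
Proof.
apply/LfuneqP => x; rewrite indic_itvE /L2_affine [RHS]indic_itvE.
by rewrite ltr_pdivlMr// mul0r ler_pdivrMr// mul1r subr_gt0 lerBlDr subrK.
Qed.

(** The signed indicator of the interval between 0 and t: a path in L2 whose
    increments are the indicators of intervals. *)
Definition step (t : R) : L2 := indic_itv 0 t - indic_itv t 0.

Lemma stepB a b : a <= b -> step b - step a = indic_itv a b.
Proof.
move=> ab; apply/LfuneqP => x.
rewrite /step !(L2DE, L2NE) !indic_itvE.
case: (ltP 0 x); case: (leP x b); case: (leP x a); case: (leP x 0);
  by case: (ltP b x); case: (ltP a x) => //=; lra.
Qed.

Section bounded_form.
Variable E : L2 -> R.
Hypotheses (qE : quadratic E) (E_bound : forall f, `|E f| <= sqnorm f).
Hypothesis E_itv : forall a b, a < b -> E (indic_itv a b) = 0.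

Let E_step a b : E (step a - step b) = 0.
Proof.
wlog ab : a b / a < b.
  move=> H; have [ab|ba|->] := ltgtP a b; first exact: H.
    by rewrite -opprB (quadraticN qE); exact: H.
  by rewrite subrr (quadratic0 qE).
by rewrite -opprB (quadraticN qE) stepB ?(ltW ab)// E_itv.
Qed.

(* By polarisation, as E vanishes on step a, on step b and on
   their difference. *)
Let polar_step a b : polar E (step a) (step b) = 0.
Proof.
have s0 : step 0 = 0 by rewrite /step subrr.
have E1 t : E (step t) = 0 by rewrite -[step t]subr0 -s0 E_step.
by rewrite (polarE qE) !E1 E_step addr0 subrr mulr0.
Qed.

(** The polar form vanishes on pairs of steps; density is applied to one
    argument, then to the other. *)
Lemma quadratic_itv_eq0 f : E f = 0.
Proof.
have key (u : L2) : (forall t, polar E u (step t) = 0) -> forall v, polar E u v = 0.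
  move=> u0; apply: (@L2_induction _ [set v | polar E u v = 0]) => /=.
  - by move=> v w v0 w0; rewrite (polarDr qE) v0 w0 addr0.
  - by move=> r v v0; rewrite (polarZr qE sqnorm_quadratic E_bound) v0 mulr0.
  - move=> v H; apply: (polar_approx qE sqnorm_quadratic E_bound) => e e0.
    by have [w [w0 vw]] := H e e0; exists w.
  - move=> v a b vE.
    have [ab|ba] := leP a b.
      have -> : v = step b + (-1) *: step a.
        by rewrite scaleN1r stepB//; apply/LfuneqP => x; rewrite vE.
      by rewrite (polarDr qE) (polarZr qE sqnorm_quadratic E_bound) !u0 mulr0 addr0.
    have -> : v = 0 *: step 0.
      rewrite scale0r; apply/LfuneqP => x; rewrite vE indicE mem_setE in_itv/=.
      by case: ltP => //= ax; rewrite leNgt (lt_trans ba ax).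
    by rewrite (polarZr qE sqnorm_quadratic E_bound) u0 mulr0.
have ff : polar E f f = 0.
  by apply: (key) => t; rewrite (polarC qE); apply: (key) => s; exact: polar_step.
have := polarxx qE f; rewrite ff => /esym/eqP.
by rewrite mulf_eq0 pnatr_eq0/= => /eqP.
Qed.

End bounded_form.

(** Translations and dilations carry the unit interval to any other, which
    determines q on intervals. *)
Lemma quadratic_affine_scalar (q : L2 -> R) : quadratic q ->
  (forall f, 0 <= q f <= sqnorm f) ->
  (forall a b (a0 : 0 < a) f, q (L2_affine b a0 f) = a * q f) ->
  forall f, q f = q (indic_itv 0 1) * sqnorm f.
Proof.
move=> qq q_bound q_affine f; set c := q (indic_itv 0 1).
have /andP[c0 c1] : 0 <= c <= 1.
  by have := q_bound (indic_itv 0 1); rewrite sqnorm_indic_itv// subr0.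
apply/eqP; rewrite -subr_eq0; apply/eqP.
apply: (@quadratic_itv_eq0 (fun f => q f - c * sqnorm f)).
- exact: quadraticB qq sqnorm_quadratic.
- move=> g; have /andP[q0 qn] := q_bound g; have n0 := sqnorm_ge0 g.
  have cn0 : 0 <= c * sqnorm g by rewrite mulr_ge0.
  have cn1 : c * sqnorm g <= sqnorm g by rewrite ler_piMl.
  by rewrite ler_norml; apply/andP; split; lra.
- move=> a b ab; have ab' : 0 < b - a by rewrite subr_gt0.
  rewrite {1}(indic_itv_affine ab') q_affine sqnorm_indic_itv ?(ltW ab)//.
  by rewrite -/c mulrC subrr.
Qed.

End interval_indicators.

Section affine_invariance.
Context {R : realType}.
Local Notation mu := (@lebesgue_measure R).
Local Notation L2 := (LfunType mu (lee1n 2)).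
Variable N : set L2.
Hypotheses (N0 : N 0) (ND : forall f g, N f -> N g -> N (f + g))
  (NZ : forall r f, N f -> N (r *: f))
  (NA : forall a b (a0 : 0 < a) f, N f -> N (L2_affine b a0 f)).

Local Notation q := (sqdist (@sqnorm R) N).

Lemma sqdist_affine a b (a0 : 0 < a) f : q (L2_affine b a0 f) = a * q f.
Proof.
have le a' b' (a0' : 0 < a') g : q (L2_affine b' a0' g) <= a' * q g.
  rewrite -ler_pdivrMl//; apply: le_sqdist => // k Nk.
  rewrite ler_pdivrMl// -(sqnorm_affine b' a0') L2_affineB.
  by apply: sqdist_le; [exact: sqnorm_ge0 | exact: NA].
apply/eqP; rewrite eq_le le /= -ler_pdivlMl//.
have ia0 : 0 < a^-1 by rewrite invr_gt0.
have AK : L2_affine (- b / a) ia0 (L2_affine b a0 f) = f.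
  apply/LfuneqP => x; rewrite /L2_affine /=.
  by congr (f _); field; rewrite gt_eqF.
by have := le _ (- b / a) ia0 (L2_affine b a0 f); rewrite AK.
Qed.

(** At g, which is orthogonal to N, the squared distance to N is the squared norm,
    so the constant of proportionality is 1; on N itself the distance is 0. *)
Lemma affine_irreducible f g : N f -> (forall k, N k -> dotp g k = 0) ->
  sqnorm g != 0 -> sqnorm f = 0.
Proof.
move=> Nf gN g0.
have n0 := @sqnorm_ge0 R.
have sca := @quadratic_affine_scalar R q
  (sqdist_quadratic sqnorm_quadratic n0 N0 ND NZ)
  (fun h => introT andP (conj (sqdist_ge0 n0 N0 h) (sqdist_bound n0 N0 h)))
  sqdist_affine.
have qg : q g = sqnorm g.
  apply/eqP; rewrite eq_le (sqdist_bound n0 N0)/=.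
  by apply: (le_sqdist N0) => k Nk; rewrite sqnormB gN// mulr0 subr0 lerDl n0.
have c1 : q (indic_itv 0 1) = 1.
  by apply: (mulIf g0); rewrite mul1r -sca.
have := sca f; rewrite c1 mul1r => <-.
exact: (sqdist_mem sqnorm_quadratic n0 N0 Nf).
Qed.
End affine_invariance.

Section injectivity.
Context {R : realType}.
Local Notation mu := (@lebesgue_measure R).
Local Notation L2 := (LfunType mu (lee1n 2)).

(** The orthogonal complement of the affine orbit of phi is affine-invariant, as
    affine maps form a group, and phi is orthogonal to it. *)
Lemma wavelet_injective (phi f : L2) : sqnorm phi != 0 ->
  (forall a b, 0 < a -> \int[mu]_x (f x * phi ((x - b) / a)) = 0) ->
  sqnorm f = 0.
Proof.
move=> phi0 fN.
pose N : set L2 :=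
  [set h | forall a b (a0 : 0 < a), dotp h (L2_affine b a0 phi) = 0].
apply: (@affine_irreducible R N _ _ _ _ f phi) => //.
- by move=> a b a0; rewrite -(scale0r phi) dotpZl mul0r.
- by move=> g h Ng Nh a b a0; rewrite dotpDl Ng Nh addr0.
- by move=> r h Nh a b a0; rewrite dotpZl Nh mulr0.
- move=> a b a0 h Nh a' b' a0'.
  have a'a : 0 < a' / a by rewrite divr_gt0.
  have := Nh _ ((b' - b) / a) a'a => /(congr1 ( *%R a)); rewrite mulr0 => <-.
  rewrite /dotp -(Rintegral_affine b a0 (integrable_mul _ _)).
  apply: eq_Rintegral => x _ /=; congr (h _ * phi _).
  by field; rewrite !gt_eqF.
- move=> k Nk; rewrite dotpC.
  have <- : L2_affine 0 ltr01 phi = phi.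
    by apply/LfuneqP => x /=; rewrite subr0 divr1.
  exact: Nk.
Qed.
End injectivity.

(** * Real-analytic functions on the line *)

Section analytic_line.
Context {R : realType}.
Implicit Types (f : R -> R) (x y : R).
Local Notation mu := (@lebesgue_measure R).

Definition analytic_at f x := exists c : nat -> R,
  \forall y \near x, series (fun k => c k * (y - x) ^+ k) @ \oo --> f y.

(** The tail after the first nonzero term c_m s^m is at most
    K (t^(m+1) + t^(m+2) + ...); for t <= 1/2 a power t^k is at most
    2 (t^k - t^(k+1)), which makes the bound telescope. *)
Lemma series_tail_bound (c : nat -> R) (K t s : R) (m : nat) :
  0 <= t <= 2^-1 -> (forall k, `|c k * s ^+ k| <= K * t ^+ k) ->
  (forall k, (k < m)%N -> c k = 0) ->
  forall j, `|series (fun k => c k * s ^+ k) (m.+1 + j)%N - c m * s ^+ m|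
    <= 2 * K * (t ^+ m.+1 - t ^+ (m.+1 + j)).
Proof.
move=> /andP[t0 t1] cK cm; elim=> [|j IH].
  rewrite addn0 subrr mulr0 seriesSr /series /= big_nat big1 ?add0r ?subrr ?normr0//.
  by move=> k /= km; rewrite cm// mul0r.
rewrite addnS seriesSr addrAC; apply: le_trans (ler_normD _ _) _.
rewrite [t ^+ (m.+1 + j).+1]exprSr; have := cK (m.+1 + j)%N.
have tk : 0 <= t ^+ (m.+1 + j) by exact: exprn_ge0.
have K0 : 0 <= K.
  by have := cK 0%N; rewrite !expr0 !mulr1 => /(le_trans (normr_ge0 _)).
have : K * t ^+ (m.+1 + j) * t <= K * t ^+ (m.+1 + j) * 2^-1.
  by rewrite ler_wpM2l// mulr_ge0.
move: (t ^+ (m.+1 + j)) IH tk => u IH tk h1 h2.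
by rewrite mulrBr in IH; rewrite mulrBr; lra.
Qed.

(** Close to x, the first nonzero term of the power series dominates the sum of
    all the later ones. *)
Lemma analytic_isolated f x : analytic_at f x ->
  (\forall y \near x, f y = 0) \/ (\forall y \near x^', f y != 0).
Proof.
move=> [c fc].
have [c0|] := pselect (forall k, c k = 0).
  left; near=> y.
  have : series (fun k => c k * (y - x) ^+ k) @ \oo --> f y by near: y.
  move=> /(cvg_lim (@Rhausdorff R)) <-; apply: lim_near_cst => //.
  by apply: nearW => n; rewrite /series/= big1// => k _; rewrite c0 mul0r.
move=> /existsNP cn0; right.
have [m cm cmin] : exists2 m, c m != 0 & forall k, (k < m)%N -> c k = 0.
  have ex : exists k, c k != 0 by have [k /eqP ck] := cn0; exists k.
  exists (ex_minn ex); first by case: ex_minnP.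
  case: ex_minnP => m _ mmin k km; apply/eqP/negPn/negP => ck.
  by have := mmin k ck; rewrite leqNgt km.
have [e /= e0 fe] := (nbhs_ballP _ _).1 fc.
(* The terms are bounded at radius r, inside the ball of convergence. *)
pose r := e / 2.
have r0 : 0 < r by rewrite divr_gt0.
have rlt : r < e by rewrite /r ltr_pdivrMr// ltr_pMr// ltr1n.
have cv_r : series (fun k => c k * r ^+ k) @ \oo --> f (x + r).
  have /= := fe (x + r); rewrite /ball/= opprD addNKr normrN gtr0_norm// => /(_ rlt).
  by rewrite addrAC subrr add0r.
have [K K0 cK] : exists2 K, 0 <= K & forall k, `|c k * r ^+ k| <= K.
  have cv0 : cvgn (fun k => c k * r ^+ k).
    exact: (cvgP _ (cvg_series_cvg_0 (cvgP _ cv_r))).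
  have [M [_ bM]] := cvg_seq_bounded cv0.
  have cK k : `|c k * r ^+ k| <= M + 1 by apply: bM => //; rewrite ltrDl.
  by exists (M + 1) => //; exact: le_trans (normr_ge0 _) (cK 0%N).
have Cr0 : 0 < `|c m| * r ^+ m by rewrite mulr_gt0 ?normr_gt0// exprn_gt0.
(* If t = |y - x| / r < d, then f y = 0 would force
   |c_m| r^m <= 2 K t < |c_m| r^m. *)
pose d := Num.min 2^-1 (`|c m| * r ^+ m / (2 * K + 1)).
have K1 : 0 < 2 * K + 1 by lra.
have d0 : 0 < d by rewrite lt_min invr_gt0 ltr0n/= divr_gt0.
apply/nbhs_ballP; exists (r * d); first exact: mulr_gt0.
move=> y /= xy yx; apply/negP => /eqP fy0.
move: xy; rewrite /ball/= distrC => xy.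
have yx0 : y - x != 0 by rewrite subr_eq0.
pose t := `|y - x| / r.
have t0 : 0 < t by rewrite divr_gt0// normr_gt0.
have td : t < d by rewrite /t ltr_pdivrMr// mulrC.
have [t2 tC] : t < 2^-1 /\ t * (2 * K + 1) < `|c m| * r ^+ m.
  by move: td; rewrite /d lt_min => /andP[-> /=]; rewrite ltr_pdivlMr.
have yxE : `|y - x| = t * r by rewrite /t divfK// gt_eqF.
have cKt k : `|c k * (y - x) ^+ k| <= K * t ^+ k.
  rewrite normrM normrX yxE exprMn mulrCA mulrC ler_wpM2r ?exprn_ge0 ?(ltW t0)//.
  by have := cK k; rewrite normrM normrX (gtr0_norm r0).
have cv_y : series (fun k => c k * (y - x) ^+ k) @ \oo --> 0.
  rewrite -fy0; apply: fe; rewrite /ball/= distrC (lt_trans _ rlt)// yxE.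
  by rewrite gtr_pMl// (lt_trans t2)// invf_lt1// ltr1n.
have bnd : `|0 - c m * (y - x) ^+ m| <= 2 * K * t ^+ m.+1.
  have t01 : 0 <= t <= 2^-1 by rewrite !ltW.
  apply: (@cvg_norm_le _ (fun j => series (fun k => c k * (y - x) ^+ k) (m.+1 + j)%N
      - c m * (y - x) ^+ m)) => [|j].
    apply: cvgB; last exact: cvg_cst.
    have := cvg_comp _ _ (cvg_addnl m.+1) cv_y; exact.
  apply: le_trans (series_tail_bound t01 cKt cmin j) _.
  by rewrite ler_wpM2l ?mulr_ge0// gerBl exprn_ge0// ltW.
move: bnd; rewrite sub0r normrN normrM normrX yxE exprMn exprS.
have tm : 0 < t ^+ m by exact: exprn_gt0.
rewrite mulrCA [2 * K * _]mulrA [leRHS]mulrC ler_pM2l// => h.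
by lra.
Unshelve. all: by end_near. Qed.

(** Identity theorem.  The zeros in some compact piece of I are infinite in
    number, as A is uncountable, so they accumulate at a point p of I; near p
    the function is zero.  The set U of points near which f is zero is open, and
    by isolation of the other zeros also closed in I. *)
Lemma analytic_eq0 f (I A : set R) (a b : nat -> R) :
  connected I -> (forall n, `[a n, b n]%classic `<=` I) ->
  I `<=` \bigcup_n `[a n, b n]%classic ->
  (forall x, I x -> analytic_at f x) ->
  A `<=` I -> mu A != 0%E -> (forall x, A x -> f x = 0) ->
  forall x, I x -> f x = 0.
Proof.
move=> Icon abI Iab f_an AI A0 fA.
pose U : set R := [set x : R | \forall y \near x, f y = 0].
pose W : set R := [set x : R | \forall y \near x, ~ U y].
have [n infA] : exists n, infinite_set (A `&` `[a n, b n]).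
  apply: contrapT => /forallNP fin; move/eqP : A0; apply.
  apply: countable_lebesgue_measure0.
  have -> : A = \bigcup_n (A `&` `[a n, b n]%classic).
    rewrite -setI_bigcupr; apply/seteqP; split=> [x Ax|x []//].
    by split=> //; exact/Iab/AI.
  apply: bigcup_countable => // n _.
  by apply: finite_set_countable; have /contrapT := fin n.
have bndA : bounded_set (A `&` `[a n, b n]).
  have [M [Mreal KM]] := compact_bounded (@segment_compact R (a n) (b n)).
  by exists M; split => // y My x [_ Kx]; exact: KM.
have [p Ap] := infinite_bounded_limit_point_nonempty infA bndA.
have Ip : I p.
  apply: (abI n); rewrite [X in X p](closure_id _).1; last exact: itv_closed.
  by apply: closureS (subset_limit_point Ap); exact: subIsetr.
have isolated_zero x : I x -> U x \/ nbhs x [set y | y != x -> f y != 0].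
  by move=> /f_an /analytic_isolated.
have Up : U p.
  have [//|nz] := isolated_zero p Ip.
  by have [y [yp [Ay _] /(_ yp)]] := Ap _ nz; rewrite fA ?eqxx.
suff <- : I `&` U = I by move=> x [_ /nbhs_singleton].
apply: Icon.
- by exists p.
- by exists U => //; rewrite openE => x Ux; exact: nbhs_interior.
- exists (~` W).
    by apply: open_closedC; rewrite openE => x Wx; exact: nbhs_interior.
  apply/seteqP; split=> x [Ix Ux]; split => //.
    by move=> /nbhs_singleton; exact.
  have [//|nz] := isolated_zero x Ix.
  have [//|nUx] := pselect (U x).
  exfalso; apply: Ux; rewrite /W /=; apply: filterS nz => y yfy Uy.
  have [yx|/yfy] := eqVneq y x; first by apply: nUx; rewrite -yx.
  by rewrite (nbhs_singleton Uy) eqxx.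
Qed.

End analytic_line.

(** * Real-analytic functions on the upper half-plane *)

Local Open Scope complex_scope.

Section half_plane.
Context {R : realType}.
Local Notation mu := (@lebesgue_measure R).

Lemma cvg_Re (u : nat -> R[i]) (l : R[i]) :
  u @ \oo --> (l : R[i]^o) -> (fun n => complex.Re (u n)) @ \oo --> complex.Re l.
Proof.
move=> ul; apply/cvgrPdist_lt => e e0.
have e0' : 0 < e%:C by rewrite ltcR.
have := (@cvgrPdist_lt _ R[i]^o _ _ _ _ _).1 ul e%:C e0'.
move=> [N _ Nu]; exists N => // n /Nu /= h; rewrite -ltcR; apply: le_lt_trans h.
have -> : complex.Re l - complex.Re (u n) = complex.Re (l - u n).
  by case: (l) (u n) => ? ? [].
exact: normc_ge_Re.
Qed.

Lemma analytic_at_Re (w : R -> R) (x : R) (u : R -> nat -> R[i]) (c : nat -> R[i]) :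
  (\forall y \near x, series (u y) @ \oo --> ((w y)%:C : R[i]^o)) ->
  (forall y n, u y n = c n * ((y - x) ^+ n)%:C) ->
  analytic_at w x.
Proof.
move=> cvu uE; exists (fun n => complex.Re (c n)).
apply: filterS cvu => y /cvg_Re /=.
have -> // : (fun n => complex.Re (series (u y) n)) =
  series (fun k => complex.Re (c k) * (y - x) ^+ k).
apply/funext => n; rewrite /series /=; elim: n => [|n IH]; first by rewrite !big_nil.
rewrite !big_nat_recr//= -IH uE; case: (\sum_(_ <= _ < _) _) (c n) => ? ? [? ?] /=.
by rewrite mulr0 subr0.
Qed.

(** On a slice only the monomials in one variable survive, so the sums along
    increasing total degree reduce to the partial sums of a power series. *)
Lemma real_analytic_slices (w : R * R -> R) (p : R * R) :
  real_analytic_at (fun q => (w q)%:C) p ->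
  analytic_at (fun y => w (y, p.2)) p.1 /\ analytic_at (fun y => w (p.1, y)) p.2.
Proof.
move=> [c cP].
have [[Q1 Q2] /= [nQ1 nQ2] QP] := cP.
have cP1 : \forall y \near p.1, Q1 y /\ Q2 p.2.
  by apply: filterS nQ1 => y; split=> //; exact: nbhs_singleton nQ2.
have cP2 : \forall y \near p.2, Q1 p.1 /\ Q2 y.
  by apply: filterS nQ2 => y; split=> //; exact: nbhs_singleton nQ1.
split.
- apply: (analytic_at_Re (c := fun n => c n 0%N)).
    by apply: filterS cP1 => y /(QP (y, p.2)) [_]; exact.
  move=> y n /=; rewrite big_ord_recr/= big1 ?add0r ?subnn; last first.
    by move=> i _; rewrite subrr expr0n subn_eq0 leqNgt ltn_ord mulr0 mulr0.
  by rewrite subrr expr0 mulr1.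
- apply: (analytic_at_Re (c := fun n => c 0%N n)).
    by apply: filterS cP2 => y /(QP (p.1, y)) [_]; exact.
  move=> y n /=; rewrite big_ord_recl/= big1 ?addr0 ?subn0; last first.
    by move=> i _; rewrite subrr expr0n /= mul0r mulr0.
  by rewrite subrr expr0 mul1r.
Qed.

Lemma measurable_Rintegral d (T : measurableType d)
    (h : T * measurableTypeR R -> R) :
  measurable_fun setT h -> measurable_fun setT (fun t => \int[mu]_x h (t, x)).
Proof.
move=> mh; have mEh : measurable_fun setT (EFin \o h) by exact/measurable_EFinP.
apply: (@measurableT_comp _ _ _ _ _ _ (@fine R)).
  exact: fine_measurable.
under eq_fun do rewrite integralE.
apply: emeasurable_funB.
  have := measurable_fun_fubini_tonelli_F (m2 := mu) _ (measurable_funepos mEh)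
    (fun x => funepos_ge0 _ x).
  rewrite /fubini_F; under eq_fun do under eq_integral do rewrite unlock.
  by under [in X in _ -> X]eq_fun do under eq_integral do rewrite unlock.
have := measurable_fun_fubini_tonelli_F (m2 := mu) _ (measurable_funeneg mEh)
  (fun x => funeneg_ge0 _ x).
rewrite /fubini_F; under eq_fun do under eq_integral do rewrite unlock.
by under [in X in _ -> X]eq_fun do under eq_integral do rewrite unlock.
Qed.

(** Unique continuation by slicing: vertical slices first, then horizontal
    ones. *)
Lemma half_plane_eq0 (w : R * R -> R) :
  let Z :=
    [set p : measurableTypeR R * measurableTypeR R | 0 < p.2 /\ w p = 0] in
  (forall p, 0 < p.2 -> real_analytic_at (fun q => (w q)%:C) p) ->
  measurable Z -> (mu \x mu)%E Z != 0%E ->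
  forall p, 0 < p.2 -> w p = 0.
Proof.
move=> Z w_an mZ Z0.
pose B : set R := [set b | mu (xsection Z b) != 0%E].
have muB : mu B != 0%E.
  apply: contra_neq Z0 => B0; rewrite /product_measure1.
  have mxs := measurable_fun_xsection mu mZ.
  rewrite (ae_eq_integral (cst 0%E))//; first by rewrite integral0.
  exists B; split => //; last first.
    by move=> b /=; rewrite /B /=; apply: contra_not_neq => ->.
  rewrite (_ : B = (fun b => mu (xsection Z b)) @^-1` (~` [set 0%E])); last first.
    by apply/seteqP; split => b; [move/eqP|move/eqP].
  by rewrite -[X in measurable X]setTI; apply: mxs => //; exact: measurableC.
have vert b a : B b -> 0 < a -> w (b, a) = 0.
  move=> Bb a0.
  apply: (@analytic_eq0 R (fun y => w (b, y)) `]0, +oo[%classic (xsection Z b)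
    (fun n => n.+1%:R^-1) (fun n => n%:R)) => //.
  - exact/connected_intervalP/interval_is_interval.
  - move=> n y /=; rewrite !in_itv/= andbT => /andP[+ _]; apply: lt_le_trans.
    by rewrite invr_gt0.
  - move=> y /=; rewrite in_itv/= andbT => y0.
    exists (maxn (Num.truncn y).+1 (Num.truncn y^-1)) => //=.
    rewrite in_itv/=; apply/andP; split.
      rewrite -[leRHS]invrK lef_pV2 ?posrE ?invr_gt0//.
      apply: (le_trans (ltW (truncnS_gt _))); rewrite ler_nat ltnS.
      exact: leq_maxr.
    apply: (le_trans (ltW (truncnS_gt _))); rewrite ler_nat.
    exact: leq_maxl.
  - move=> y /=; rewrite in_itv/= andbT => y0.
    exact: (real_analytic_slices (w_an (b, y) y0)).2.
  - by move=> y; rewrite /xsection /= inE => -[/= y0 _]; rewrite in_itv/= y0.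
  - by move=> y; rewrite /xsection /= inE => -[].
  - by rewrite /= in_itv/= a0.
move=> [b a] /= a0.
apply: (@analytic_eq0 R (fun y => w (y, a)) setT B (fun n => - n%:R)
  (fun n => n%:R)) => //.
- by apply/connected_intervalP => ? ? ? ? ? ?.
- move=> y _; exists (Num.truncn `|y|).+1 => //=.
  by rewrite in_itv/= -ler_norml ltW// truncnS_gt.
- by move=> y _; exact: (real_analytic_slices (w_an (y, a) a0)).1.
- by move=> y By; exact: vert.
Qed.

End half_plane.

(** * Zeros of wavelet transforms *)

Section wavelet_zeros.
Context {R : realType}.
Local Notation mu := (@lebesgue_measure R).

(** The wavelet transform without its factor a^(-1/2), which has no influence on
    its zeros. *)
Definition wavelet_coef (f phi : R -> R) (p : R * R) : R :=
  \int[mu]_x (f x * phi ((x - p.1) / p.2)).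

Lemma wavelet_transform_real (phi f : R -> R) (p : R * R) :
  wavelet_transform (fun x => (phi x)%:C) (fun x => (f x)%:C) p =
  (p.2 `^ (- 2^-1) * wavelet_coef f phi p)%:C.
Proof.
rewrite /wavelet_transform /integralC /wavelet_coef.
have -> : \int[mu]_x complex.Im ((f x)%:C * (phi ((x - p.1) / p.2))%:C^*) = 0.
  rewrite /Rintegral; under eq_integral => x _ do rewrite /= oppr0 mulr0 mul0r addr0.
  by rewrite integral0.
under eq_Rintegral => x _ do rewrite /= mul0r subr0.
by rewrite rmorphM.
Qed.

Lemma measurable_wavelet_zeros (f phi : R -> R) :
  measurable_fun setT f -> measurable_fun setT phi ->
  measurable [set p : measurableTypeR R * measurableTypeR R |
     0 < p.2 /\ wavelet_coef f phi p = 0].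
Proof.
move=> mf mphi; rewrite /wavelet_coef.
(* The scale enters as the power a^(-1), a measurable function of a on the whole
   line, which is the inverse of a on positive scales. *)
pose h (z : (measurableTypeR R * measurableTypeR R) * measurableTypeR R) : R :=
  f z.2 * phi ((z.2 - z.1.1) * z.1.2 `^ (- 1)).
have mh : measurable_fun setT h.
  apply: measurable_funM; first exact: (measurableT_comp mf).
  apply: (measurableT_comp mphi); apply: measurable_funM.
    by apply: measurable_funB => //; exact: measurableT_comp.
  apply: (measurableT_comp (measurable_powR _)); exact: measurableT_comp.
have mv := measurable_Rintegral mh.
rewrite (_ : [set p | _] = (snd @^-1` `]0, +oo[%classic) `&`
   ((fun t => \int[mu]_x h (t, x)) @^-1` [set 0])).
  apply: measurableI; rewrite -[X in measurable X]setTI.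
    by apply: measurable_snd.
  by apply: mv.
apply/seteqP; split => -[b a] /=; rewrite in_itv/= andbT /h/= => -[a0 H]; split=> //.
  by rewrite powR_inv1 ?ltW.
by move: H; rewrite powR_inv1 ?ltW.
Qed.

Lemma wavelet_coef_analytic (phi f : R -> R) (p : R * R) :
  Ran_wavelet (fun x => (phi x)%:C) `<=` analytic_upper_half_plane ->
  f \in Lfun mu 2%:E -> 0 < p.2 ->
  real_analytic_at (fun q => (q.2 `^ (- 2^-1) * wavelet_coef f phi q)%:C) p.
Proof.
move=> an f2 p0.
have <- : wavelet_transform (fun x => (phi x)%:C) (fun x => (f x)%:C) =
    (fun q => (q.2 `^ (- 2^-1) * wavelet_coef f phi q)%:C).
  by apply/funext => q; exact: wavelet_transform_real.
apply: (an _ _ p p0); exists (fun x => (f x)%:C) => //.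
exact/L2C_real.
Qed.

(** Monotonicity of almost-everywhere statements for predicates on R itself
    rather than on its copy that carries the Borel sets. *)
Lemma ae_sub (P Q : R -> Prop) : (forall x, P x -> Q x) ->
  (\forall x \ae mu, P x) -> \forall x \ae mu, Q x.
Proof. by move=> PQ; apply: (@filterS (measurableTypeR R) _ _ P Q PQ). Qed.

Lemma wavelet_coef_ae (phi : R -> R) (f g : LfunType mu (lee1n 2)) (p : R * R) :
  phi \in Lfun mu 2%:E -> 0 < p.2 ->
  (f : R -> R) = g %[ae mu] -> wavelet_coef f phi p = wavelet_coef g phi p.
Proof.
move=> phi2 p0 fg; pose Phi := L2_affine p.1 p0 (Lfun_Sub (lee1n 2) phi2).
rewrite /wavelet_coef /Rintegral; congr fine; apply: ae_eq_integral => //.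
- by have /integrableP[] := integrable_mul f Phi.
- by have /integrableP[] := integrable_mul g Phi.
by apply: (ae_sub _ fg) => x fgx /fgx /= ->.
Qed.

(** Unique continuation and injectivity together: positive measure of the zero
    set would make the transform vanish, hence f. *)
Lemma wavelet_zeros_negligible (phi f : R -> R) :
  Ran_wavelet (fun x => (phi x)%:C) `<=` analytic_upper_half_plane ->
  phi \in Lfun mu 2%:E -> ~ (phi = cst 0 %[ae mu]) ->
  f \in Lfun mu 2%:E -> ~ (f = cst 0 %[ae mu]) ->
  let Z := [set p : measurableTypeR R * measurableTypeR R |
    0 < p.2 /\ wavelet_coef f phi p = 0] in
  measurable Z /\ (mu \x mu)%E Z = 0%E.
Proof.
move=> an phi2 phi0 f2 f0 Z.
have [mphi _] := (Lfun2P phi).1 phi2; have [mf _] := (Lfun2P f).1 f2.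
have mZ : measurable Z by exact: measurable_wavelet_zeros.
split => //; apply/eqP/negPn/negP => muZ; apply: f0.
pose w (q : R * R) := q.2 `^ (- 2^-1) * wavelet_coef f phi q.
have wE (q : R * R) : 0 < q.2 -> (w q = 0) = (wavelet_coef f phi q = 0).
  move=> q0; apply/propext; split=> [/eqP|c0]; last by rewrite /w c0 mulr0.
  by rewrite mulf_eq0 gt_eqF ?powR_gt0//= => /eqP.
have ZE : Z = [set p : measurableTypeR R * measurableTypeR R | 0 < p.2 /\ w p = 0].
  apply/seteqP; split => q /= [q0 q_eq0]; split => //.
    by rewrite (wE q q0).
  by rewrite -(wE q q0).
have w0 : forall p, 0 < p.2 -> w p = 0.
  apply: half_plane_eq0; rewrite -?ZE// => p p0; exact: wavelet_coef_analytic.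
have := @sqnorm_eq0 R (Lfun_Sub (lee1n 2) f2); apply.
apply: (@wavelet_injective R (Lfun_Sub (lee1n 2) phi2)).
  by apply/eqP => /sqnorm_eq0.
by move=> a b a0; have := w0 (b, a) a0; rewrite (wE (b, a) a0).
Qed.

End wavelet_zeros.

(** * Phase retrieval up to sign *)

Theorem theorem3p1 (R : realType) (Omega : set (R * R)) (phi : R -> R)
  (Omega_upper : Omega `<=` [set p | 0 < p.2])
  (Omega_measurable : lebesgue_measurable2 Omega)
  (Omega_pos : (0 < lebesgue_measure2 Omega)%E)
  (phi_L2 : phi \in Lfun lebesgue_measure 2%:E)
  (phi_neq0 : ~ (phi = cst 0 %[ae lebesgue_measure]))
  (phi_analytic : Ran_wavelet (fun x => (phi x)%:C) `<=` analytic_upper_half_plane)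
  (f g : R -> R)
  (f_L2 : f \in Lfun lebesgue_measure 2%:E)
  (g_L2 : g \in Lfun lebesgue_measure 2%:E) :
  (f = g %[ae lebesgue_measure] \/ f = (\- g) %[ae lebesgue_measure]) <->
  (forall p, Omega p ->
     `|wavelet_transform (fun x => (phi x)%:C) (fun x => (f x)%:C) p| =
     `|wavelet_transform (fun x => (phi x)%:C) (fun x => (g x)%:C) p|).
Proof.
have normE (h : R -> R) p : 0 < p.2 ->
    `|wavelet_transform (fun x => (phi x)%:C) (fun x => (h x)%:C) p| =
    (p.2 `^ (- 2^-1) * `|wavelet_coef h phi p|)%:C.
  move=> p0; rewrite wavelet_transform_real normc_def /= expr0n addr0 sqrtr_sqr.
  by rewrite normrM ger0_norm ?powR_ge0.
pose F := Lfun_Sub (lee1n 2) f_L2; pose G := Lfun_Sub (lee1n 2) g_L2.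
pose Phi := Lfun_Sub (lee1n 2) phi_L2.
have intE (h : LfunType lebesgue_measure (lee1n 2)) (p : R * R) (p0 : 0 < p.2) :
  wavelet_coef h phi p = dotp h (L2_affine p.1 p0 Phi) by [].
split=> [fg p /Omega_upper p0|norm_eq].
  rewrite !normE//; congr (_ * _)%:C.
  case: fg => [/(@wavelet_coef_ae _ phi F G p phi_L2 p0) -> //|fg].
  have -> := @wavelet_coef_ae _ phi F (- G) p phi_L2 p0 fg.
  by rewrite !(intE _ _ p0) -scaleN1r dotpZl mulN1r normrN.
pose Z (h : LfunType lebesgue_measure (lee1n 2)) :
  set (measurableTypeR R * measurableTypeR R) :=
  [set p | 0 < p.2 /\ wavelet_coef h phi p = 0].
have cover : Omega `<=` Z (F - G) `|` Z (F + G).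
  move=> p Op; have p0 := Omega_upper p Op; have := norm_eq p Op.
  rewrite !normE// => /(congr1 (@complex.Re R)) /= /mulfI.
  rewrite gt_eqF ?powR_gt0// => /(_ isT) /eqP; rewrite eqr_norm2.
  rewrite !(intE F, intE G) => /orP[/eqP e|/eqP e]; [left|right]; split => //;
    rewrite intE.
    by rewrite -scaleN1r dotpDl dotpZl mulN1r e subrr.
  by rewrite dotpDl e addNr.
apply: contrapT => /not_orP[fg fNg].
have [mZ1 Z1] : measurable (Z (F - G)) /\
    (lebesgue_measure \x lebesgue_measure)%E (Z (F - G)) = 0%E.
  apply: wavelet_zeros_negligible => //; first exact: LfunP.
  apply: contra_not fg; apply: ae_sub => x /[apply] /= /eqP.
  by rewrite subr_eq0 => /eqP.
have [mZ2 Z2] : measurable (Z (F + G)) /\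
    (lebesgue_measure \x lebesgue_measure)%E (Z (F + G)) = 0%E.
  apply: wavelet_zeros_negligible => //; first exact: LfunP.
  apply: contra_not fNg; apply: ae_sub => x /[apply] /= /eqP.
  by rewrite addr_eq0 => /eqP.
move: Omega_pos; apply/negP; rewrite -leNgt.
rewrite (le_trans (le_mu_ext _ cover))//.
have muE := measurable_mu_extE (lebesgue_measure \x lebesgue_measure)%E
  (measurableU _ _ mZ1 mZ2).
rewrite [leLHS]muE.
rewrite (le_trans (measureU2 _ mZ1 mZ2))//.
by rewrite [X in (X + _)%E]Z1 [X in (_ + X)%E]Z2 adde0.
Qed.
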